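(* Let $q>0$. There exists a canonical transformation to ''action-angle'' coordinates $$\mathbb{R}_+^\ast\times\mathbb{R}\ni(r,v)\mapsto(\Theta(r,v),\mathcal{A}(r,v))\in\mathbb{R}\times\mathbb{R}_+^\ast$$ with inverse $(R(\theta,a),V(\theta,a))$, such that a function $f(r,v,t)$ solves $$\left(\partial_t+v\partial_r+\frac{q}{2r^2}\partial_v\right)f=0$$ if and only if $g(\theta,a,t):=f(R(\theta,a),V(\theta,a),t)$ solves the free streaming equation $$(\partial_t+a\partial_\theta)g=0 .$$
   Context: $\mathbb{R}_+^\ast=(0,\infty)$. A canonical transformation is a diffeomorphism preserving the symplectic form, i.e. $d\Theta\wedge d\mathcal{A}=dr\wedge dv$. *)

(* Defs.v *)
(* Real analysis on Stdlib's R, with Coquelicot. *)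
From Stdlib Require Import Reals.
From Coquelicot Require Import Coquelicot.
Open Scope R_scope.

(* On an open set D, having continuous iterated partial derivatives of all
   orders is being C^oo on D. *)
Definition smooth_on (D : R -> R -> Prop) (F : R -> R -> R) : Prop :=
  forall (n : nat) (x y : R), D x y -> ex_diff_n F n x y.

(* (F, G) is a C^oo diffeomorphism from D onto E, with inverse (F', G').
   All functions are total; only their values on D, resp. E, matter, and
   D and E are meant to be open. *)
Definition diffeomorphism (D E : R -> R -> Prop)
    (F G F' G' : R -> R -> R) : Prop :=
  (forall x y, D x y -> E (F x y) (G x y)) /\
  (forall x y, E x y -> D (F' x y) (G' x y)) /\
  (forall x y, D x y ->
     F' (F x y) (G x y) = x /\ G' (F x y) (G x y) = y) /\
  (forall x y, E x y ->
     F (F' x y) (G' x y) = x /\ G (F' x y) (G' x y) = y) /\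
  smooth_on D F /\ smooth_on D G /\ smooth_on E F' /\ smooth_on E G'.

(* Differential forms on the plane: a 1-form at a point is a function of one
   tangent vector, a 2-form at a point a function of two tangent vectors. *)
Definition differential (F : R -> R -> R) (x y : R) (h : R * R) : R :=
  Derive (fun s => F s y) x * fst h + Derive (fun s => F x s) y * snd h.

Definition wedge (alpha beta : R * R -> R) (h k : R * R) : R :=
  alpha h * beta k - alpha k * beta h.

(* dF /\ dG = dx /\ dy at every point of D. *)
Definition symplectic_on (D : R -> R -> Prop) (F G : R -> R -> R) : Prop :=
  forall x y, D x y -> forall h k : R * R,
    wedge (differential F x y) (differential G x y) h k =
    wedge (differential (fun x _ => x) x y)
          (differential (fun _ y => y) x y) h k.

Definition canonical_transformation (D E : R -> R -> Prop)
    (F G F' G' : R -> R -> R) : Prop :=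
  diffeomorphism D E F G F' G' /\ symplectic_on D F G.

Definition phase_space (r v : R) : Prop := 0 < r.

Definition action_angle_space (theta a : R) : Prop := 0 < a.

(* Frechet differentiability of a function of three real variables. *)
Definition differentiable3 (f : R -> R -> R -> R) (x y t : R) : Prop :=
  ex_filterdiff
    (fun p : R * R * R => f (fst (fst p)) (snd (fst p)) (snd p))
    (locally ((x, y, t) : R * R * R)).

(* Pointwise solutions, for times in an open set J. Joint differentiability
   is part of the notion: existence of the partial derivatives alone would
   not survive a change of variables. *)
Definition solves_transport (q : R) (J : R -> Prop)
    (f : R -> R -> R -> R) : Prop :=
  forall r v t, phase_space r v -> J t ->
    differentiable3 f r v t /\
    Derive (fun s => f r v s) t + v * Derive (fun s => f s v t) r
      + q / (2 * r ^ 2) * Derive (fun s => f r s t) v = 0.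

Definition solves_free_streaming (J : R -> Prop)
    (g : R -> R -> R -> R) : Prop :=
  forall theta a t, action_angle_space theta a -> J t ->
    differentiable3 g theta a t /\
    Derive (fun s => g theta a s) t
      + a * Derive (fun s => g s a t) theta = 0.

(* Main.v *)
Require Import Defs.
From Stdlib Require Import Reals Lra.
From Coquelicot Require Import Coquelicot.
Open Scope R_scope.

(** The flow has Hamiltonian [H = v^2/2 + q/(2r)], and the action is
    [a = sqrt (2H) = sqrt (v^2 + q/r)], the speed at infinity.  An orbit of
    action [a] is parametrised by [r = (q/a^2) cosh^2 (w/2)],
    [v = a tanh (w/2)], and the time elapsed since periapsis, multiplied by [a],
    is the angle [theta = q/(2 a^2) (w + sinh w)], where
    [exp w = (a + v) / (a - v)].  Since [w + sinh w] is a diffeomorphism of the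
    line with derivative at least 1, the map can be inverted smoothly.  The
    transport field is [a] times the pushforward of [d/dtheta], so the two
    equations correspond pointwise through the chain rule. *)

(** * Iterated continuous differentiability in the plane *)

Definition open_2d (D : R -> R -> Prop) : Prop :=
  forall x y, D x y -> locally_2d D x y.

(** The partial derivatives are existential witnesses valid on all of [D], so closure under each
    operation is proved by exhibiting formulas rather than by computing with [Derive]. *)
Fixpoint Ck (n : nat) (D : R -> R -> Prop) (F : R -> R -> R) : Prop :=
  (forall x y, D x y -> continuity_2d_pt F x y) /\
  match n with
  | O => True
  | S m => exists Fx Fy : R -> R -> R,
      (forall x y, D x y ->
         is_derive (fun s => F s y) x (Fx x y) /\
         is_derive (fun s => F x s) y (Fy x y)) /\
      Ck m D Fx /\ Ck m D Fy
  end.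

Lemma Ck_continuity n D F x y : Ck n D F -> D x y -> continuity_2d_pt F x y.
Proof. destruct n; intros [H _]; apply H. Qed.

Lemma Ck_le_S n D F : Ck (S n) D F -> Ck n D F.
Proof.
  revert F; induction n as [|n IH]; intros F [Hc (Fx & Fy & Hd & Hx & Hy)].
  - now split.
  - split; [exact Hc|]. exists Fx, Fy.
    split; [exact Hd|]; split; apply IH; assumption.
Qed.

Lemma open_2d_slices D x y : open_2d D -> D x y ->
  locally x (fun s => D s y) /\ locally y (fun s => D x s).
Proof.
  intros HD Hxy; destruct (HD x y Hxy) as [d Hd].
  split; exists d; intros s Hs; apply Hd;
    try exact Hs; rewrite Rminus_diag, Rabs_R0; apply cond_pos.
Qed.

(** Continuity and partial derivatives depend on values near the point; openness of [D] spreads the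
    equality to a neighbourhood. *)
Lemma Ck_ext n D F G : open_2d D -> (forall x y, D x y -> F x y = G x y) ->
  Ck n D F -> Ck n D G.
Proof.
  intros HD HFG HF.
  assert (Hc : forall x y, D x y -> continuity_2d_pt G x y).
  { intros x y Hxy; apply continuity_2d_pt_ext_loc with F.
    - destruct (HD x y Hxy) as [d Hd]; exists d; intros u v Hu Hv.
      apply HFG, Hd; assumption.
    - exact (Ck_continuity n D F x y HF Hxy). }
  destruct n as [|n]; destruct HF as [_ HF]; (split; [exact Hc|]); auto.
  destruct HF as (Fx & Fy & Hd & Hx & Hy); exists Fx, Fy.
  split; [|now split].
  intros x y Hxy; destruct (Hd x y Hxy) as [H1 H2].
  destruct (open_2d_slices D x y HD Hxy) as [L1 L2].
  split; (eapply is_derive_ext_loc; [|eassumption]);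
    (eapply filter_imp; [|eassumption]); intros s; apply HFG.
Qed.

(** Bridge to [smooth_on]: the witnesses agree on [D] with the [Derive] terms inside [ex_diff_n],
    and [Ck_ext] transfers their regularity. *)
Lemma Ck_ex_diff_n n D F x y : open_2d D -> Ck n D F -> D x y ->
  ex_diff_n F n x y.
Proof.
  intros HD; revert F x y; induction n as [|n IH];
    intros F x y [Hc H] Hxy; (split; [now apply Hc|]); auto.
  destruct H as (Fx & Fy & Hd & Hx & Hy).
  destruct (Hd x y Hxy) as [H1 H2].
  split; [now exists (Fx x y)|].
  split; [now exists (Fy x y)|].
  split; (apply IH; [|exact Hxy]).
  - apply (Ck_ext n D Fx); [exact HD| |exact Hx].
    intros u v Huv; symmetry; apply is_derive_unique, Hd, Huv.
  - apply (Ck_ext n D Fy); [exact HD| |exact Hy].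
    intros u v Huv; symmetry; apply is_derive_unique, Hd, Huv.
Qed.

Lemma Ck_const n D c : Ck n D (fun _ _ => c).
Proof.
  revert c; induction n as [|n IH]; intros c;
    (split; [intros; apply continuity_2d_pt_const|]); auto.
  exists (fun _ _ => 0), (fun _ _ => 0); split; [|now split].
  intros; split; apply @is_derive_const.
Qed.

Lemma Ck_fst n D : Ck n D (fun x _ => x).
Proof.
  destruct n; (split; [intros; apply continuity_2d_pt_id1|]); auto.
  exists (fun _ _ => 1), (fun _ _ => 0); split; [|split; apply Ck_const].
  intros; split; [apply @is_derive_id|apply @is_derive_const].
Qed.

Lemma Ck_snd n D : Ck n D (fun _ y => y).
Proof.
  destruct n; (split; [intros; apply continuity_2d_pt_id2|]); auto.
  exists (fun _ _ => 0), (fun _ _ => 1); split; [|split; apply Ck_const].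
  intros; split; [apply @is_derive_const|apply @is_derive_id].
Qed.

Lemma Ck_plus n D F G : Ck n D F -> Ck n D G ->
  Ck n D (fun x y => F x y + G x y).
Proof.
  revert F G; induction n as [|n IH]; intros F G [Fc HF] [Gc HG];
    (split; [intros; apply continuity_2d_pt_plus; auto|]); auto.
  destruct HF as (Fx & Fy & Fd & HFx & HFy), HG as (Gx & Gy & Gd & HGx & HGy).
  exists (fun x y => Fx x y + Gx x y), (fun x y => Fy x y + Gy x y).
  split; [|now split; apply IH].
  intros x y Hxy; destruct (Fd x y Hxy), (Gd x y Hxy).
  split; apply @is_derive_plus; assumption.
Qed.

Lemma Ck_mult n D F G : Ck n D F -> Ck n D G ->
  Ck n D (fun x y => F x y * G x y).
Proof.
  revert F G; induction n as [|n IH]; intros F G HF HG.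
  - destruct HF, HG; split; [intros; apply continuity_2d_pt_mult|]; auto.
  (* Each term of the product rule keeps one undifferentiated factor, which the induction hypothesis
     wants at the lower order. *)
  - pose proof (Ck_le_S _ _ _ HF) as HF'; pose proof (Ck_le_S _ _ _ HG) as HG'.
    destruct HF as [Fc (Fx & Fy & Fd & HFx & HFy)].
    destruct HG as [Gc (Gx & Gy & Gd & HGx & HGy)].
    split; [intros; apply continuity_2d_pt_mult; auto|].
    exists (fun x y => Fx x y * G x y + F x y * Gx x y),
           (fun x y => Fy x y * G x y + F x y * Gy x y).
    split; [|split; apply Ck_plus; apply IH; assumption].
    intros x y Hxy; destruct (Fd x y Hxy), (Gd x y Hxy).
    split.
    + apply (is_derive_mult (fun s => F s y) (fun s => G s y));
        [assumption..|exact Rmult_comm].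
    + apply (is_derive_mult (fun s => F x s) (fun s => G x s));
        [assumption..|exact Rmult_comm].
Qed.

(* The last hypothesis lets [h'] be expressed through [h] itself, as for
   exponentials, reciprocals, roots and inverse functions. *)
Lemma Ck_comp D F (h : R -> R) (h' : R -> R -> R) :
  (forall x y, D x y -> is_derive h (F x y) (h' x y)) ->
  (forall n, Ck n D F -> Ck n D (fun x y => h (F x y)) -> Ck n D h') ->
  forall n, Ck n D F -> Ck n D (fun x y => h (F x y)).
Proof.
  intros Hh Hh'.
  assert (Hc : forall n, Ck n D F -> forall x y, D x y ->
    continuity_2d_pt (fun x y => h (F x y)) x y).
  { intros n HF x y Hxy; apply (continuity_1d_2d_pt_comp h F).
    - apply continuity_pt_filterlim, (ex_derive_continuous h).
      exists (h' x y); now apply Hh.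
    - exact (Ck_continuity n D F x y HF Hxy). }
  induction n as [|n IH]; intros HF; (split; [now apply (Hc _ HF)|]); auto.
  pose proof (Ck_le_S _ _ _ HF) as HF'.
  pose proof (Hh' n HF' (IH HF')) as HK.
  destruct HF as [_ (Fx & Fy & Fd & HFx & HFy)].
  exists (fun x y => Fx x y * h' x y), (fun x y => Fy x y * h' x y).
  split; [|split; apply Ck_mult; assumption].
  intros x y Hxy; destruct (Fd x y Hxy).
  split.
  - apply (is_derive_comp h (fun s => F s y)); auto.
  - apply (is_derive_comp h (fun s => F x s)); auto.
Qed.

Lemma Ck_inv n D F : (forall x y, D x y -> F x y <> 0) -> Ck n D F ->
  Ck n D (fun x y => / F x y).
Proof.
  intros H0; revert n; apply Ck_comp with
    (h' := fun x y => (-1) * (/ F x y * / F x y)).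
  - intros x y Hxy; pose proof (H0 x y Hxy).
    auto_derive; [assumption|field; assumption].
  - intros n _ Hi; apply Ck_mult; [apply Ck_const|now apply Ck_mult].
Qed.

Lemma Ck_exp n D F : Ck n D F -> Ck n D (fun x y => exp (F x y)).
Proof.
  revert n; apply Ck_comp with (h' := fun x y => exp (F x y)).
  - intros x y _; apply is_derive_exp.
  - auto.
Qed.

Lemma Ck_ln n D F : (forall x y, D x y -> 0 < F x y) -> Ck n D F ->
  Ck n D (fun x y => ln (F x y)).
Proof.
  intros H0; revert n; apply Ck_comp with (h' := fun x y => / F x y).
  - intros x y Hxy; apply is_derive_ln; auto.
  - intros n HF _; apply Ck_inv; [|exact HF].
    intros x y Hxy; apply Rgt_not_eq, H0, Hxy.
Qed.

Lemma Ck_sqrt n D F : (forall x y, D x y -> 0 < F x y) -> Ck n D F ->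
  Ck n D (fun x y => sqrt (F x y)).
Proof.
  intros H0; revert n; apply Ck_comp with
    (h' := fun x y => / (2 * sqrt (F x y))).
  - intros x y Hxy; pose proof (H0 x y Hxy).
    auto_derive; [assumption|].
    field; now apply Rgt_not_eq, sqrt_lt_R0.
  - intros n _ Hs; apply Ck_inv.
    + intros x y Hxy; pose proof (sqrt_lt_R0 _ (H0 x y Hxy)); lra.
    + apply Ck_mult; [apply Ck_const|exact Hs].
Qed.

Lemma Ck_minus n D F G : open_2d D -> Ck n D F -> Ck n D G ->
  Ck n D (fun x y => F x y - G x y).
Proof.
  intros HD HF HG; apply (Ck_ext n D (fun x y => F x y + (-1) * G x y) _ HD).
  - intros; ring.
  - apply Ck_plus; [exact HF|apply Ck_mult; [apply Ck_const|exact HG]].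
Qed.

(** Composition with a solution requires Frechet differentiability of the coordinates. It follows
    from a first partial derivative that exists nearby and is continuous, and the second one at the
    point. *)
Lemma Ck_filterdiff D F x y : open_2d D -> Ck 1 D F -> D x y ->
  ex_filterdiff (fun u : R * R => F (fst u) (snd u)) (locally (x, y)).
Proof.
  intros HD [_ (Fx & Fy & Hd & Hx & _)] Hxy.
  eexists; apply (is_derive_filterdiff F x y Fx (Fy x y)).
  - destruct (HD x y Hxy) as [d Hl]; exists d; intros [u v] [Hu Hv].
    apply Hd, Hl; assumption.
  - now apply Hd.
  - apply continuity_2d_pt_filterlim, (Ck_continuity 0 D); assumption.
Qed.

(** * The function [w + sinh w] and its inverse *)

Definition wsinh (w : R) : R := w + (exp w - / exp w) / 2.

Definition wsinh' (w : R) : R := 1 + (exp w + / exp w) / 2.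

Lemma wsinh'_ge_1 w : 1 <= wsinh' w.
Proof.
  unfold wsinh'; pose proof (exp_pos w) as H.
  pose proof (Rinv_0_lt_compat _ H); lra.
Qed.

Lemma is_derive_wsinh w : is_derive wsinh w (wsinh' w).
Proof.
  pose proof (exp_pos w); unfold wsinh, wsinh'; auto_derive; [lra|field; lra].
Qed.

(** The [sinh] part is nondecreasing, as [exp] increases and its reciprocal decreases. Injectivity,
    surjectivity and the Lipschitz bound on the inverse all come from this. *)
Lemma wsinh_expansive_le a b : a <= b -> b - a <= wsinh b - wsinh a.
Proof.
  intros H; unfold wsinh.
  assert (exp a <= exp b) by (destruct H as [H| ->]; [left; now apply exp_increasing|lra]).
  assert (/ exp b <= / exp a) by (apply Rinv_le_contravar; [apply exp_pos|assumption]).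
  lra.
Qed.

Lemma wsinh_expansive a b : Rabs (b - a) <= Rabs (wsinh b - wsinh a).
Proof.
  destruct (Rle_dec a b) as [H|H].
  - pose proof (wsinh_expansive_le a b H); rewrite !Rabs_pos_eq; lra.
  - pose proof (wsinh_expansive_le b a ltac:(lra)).
    rewrite !(Rabs_left1 _); lra.
Qed.

Lemma wsinh_0 : wsinh 0 = 0.
Proof. unfold wsinh; rewrite exp_0; field. Qed.

(** Expansion away from [wsinh 0 = 0] makes the values at [- Rabs y] and [Rabs y] bracket [y]. The
    informative existential lets the inverse be defined by projection. *)
Lemma wsinh_surjective y : {w | wsinh w = y}.
Proof.
  assert (Hp := Rle_abs y); assert (Hm := Rle_abs (- y)); rewrite Rabs_Ropp in Hm.
  destruct (IVT_cor (fun w => wsinh w - y) (- Rabs y) (Rabs y)) as [w [_ Hw]].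
  - intros w; apply continuity_pt_filterlim.
    apply (ex_derive_continuous (fun w => wsinh w - y)).
    eexists; apply @is_derive_minus; [apply is_derive_wsinh|apply @is_derive_const].
  - lra.
  - pose proof (wsinh_expansive_le 0 (Rabs y) ltac:(lra)).
    pose proof (wsinh_expansive_le (- Rabs y) 0 ltac:(lra)).
    rewrite wsinh_0 in *.
    apply Rmult_le_0_r; lra.
  - exists w; lra.
Qed.

Definition wsinh_inv (y : R) : R := proj1_sig (wsinh_surjective y).

Lemma wsinh_wsinh_inv y : wsinh (wsinh_inv y) = y.
Proof. exact (proj2_sig (wsinh_surjective y)). Qed.

Lemma wsinh_inv_wsinh w : wsinh_inv (wsinh w) = w.
Proof.
  pose proof (wsinh_expansive w (wsinh_inv (wsinh w))) as H.
  rewrite wsinh_wsinh_inv, Rminus_diag, Rabs_R0 in H.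
  pose proof (Rabs_pos (wsinh_inv (wsinh w) - w)).
  apply Rminus_diag_uniq, Rabs_eq_0; lra.
Qed.

(** With [k] the increment of the inverse over [h] and [D] the derivative of [wsinh], [k / h - 1 / D
    = - (h / k - D) (k / h) / D]. Since [k / h] and [1 / D] are at most 1 in absolute value, the
    radius [d] that serves [wsinh] also serves its inverse. *)
Lemma is_derive_wsinh_inv y :
  is_derive wsinh_inv y (/ wsinh' (wsinh_inv y)).
Proof.
  set (w0 := wsinh_inv y); pose proof (wsinh'_ge_1 w0) as HD.
  apply is_derive_Reals; intros eps Heps.
  pose proof (is_derive_wsinh w0) as Hw; apply is_derive_Reals in Hw.
  destruct (Hw eps Heps) as [d Hd]; exists d; intros h Hh Hhd.
  set (k := wsinh_inv (y + h) - w0).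
  assert (Ek : wsinh (w0 + k) - wsinh w0 = h).
  { unfold k; replace (w0 + (wsinh_inv (y + h) - w0)) with (wsinh_inv (y + h)) by ring.
    unfold w0; rewrite !wsinh_wsinh_inv; ring. }
  (* Expansiveness of [wsinh] makes its inverse 1-Lipschitz, so [k] stays within the radius [d]. *)
  assert (Hk : Rabs k <= Rabs h).
  { rewrite <- Ek; replace k with (w0 + k - w0) at 1 by ring; apply wsinh_expansive. }
  assert (Hk0 : k <> 0).
  { intros E; apply Hh; rewrite <- Ek, E, Rplus_0_r; ring. }
  specialize (Hd k Hk0 ltac:(lra)); rewrite Ek in Hd.
  fold w0 k.
  replace (k / h - / wsinh' w0) with
    (- (h / k - wsinh' w0) * (k / h) * / wsinh' w0) by (field; lra).
  rewrite !Rabs_mult, Rabs_Ropp, Rabs_div, Rabs_inv by assumption.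
  assert (H1 : Rabs k / Rabs h <= 1).
  { apply Rmult_le_reg_r with (Rabs h); [now apply Rabs_pos_lt|].
    field_simplify; [lra|now apply Rabs_no_R0]. }
  assert (H2 : / Rabs (wsinh' w0) <= 1).
  { rewrite Rabs_pos_eq by lra; rewrite <- Rinv_1; apply Rinv_le_contravar; lra. }
  assert (0 <= Rabs k / Rabs h).
  { apply Rdiv_le_0_compat; [apply Rabs_pos|now apply Rabs_pos_lt]. }
  assert (0 <= / Rabs (wsinh' w0)).
  { left; apply Rinv_0_lt_compat, Rabs_pos_lt; lra. }
  pose proof (Rabs_pos (h / k - wsinh' w0)).
  apply Rle_lt_trans with (2 := Hd).
  rewrite <- (Rmult_1_r (Rabs (h / k - _))) at 2.
  rewrite Rmult_assoc; apply Rmult_le_compat_l; [assumption|].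
  rewrite <- (Rmult_1_r 1); apply Rmult_le_compat; assumption.
Qed.
Lemma Ck_wsinh n D F : open_2d D -> Ck n D F -> Ck n D (fun x y => wsinh (F x y)).
Proof.
  intros HD HF; pose proof (Ck_exp n D F HF) as HE; unfold wsinh.
  apply Ck_plus; [exact HF|].
  apply Ck_mult; [|apply Ck_const].
  apply Ck_minus; [exact HD|exact HE|].
  apply Ck_inv; [|exact HE].
  intros; apply Rgt_not_eq, exp_pos.
Qed.

Lemma Ck_wsinh_inv n D F : Ck n D F -> Ck n D (fun x y => wsinh_inv (F x y)).
Proof.
  revert n; apply Ck_comp with
    (h' := fun x y => / wsinh' (wsinh_inv (F x y))).
  - intros x y _; apply is_derive_wsinh_inv.
  - intros n _ HW; apply Ck_inv.
    + intros x y _; pose proof (wsinh'_ge_1 (wsinh_inv (F x y))); lra.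
    + pose proof (Ck_exp n D _ HW) as HE.
      apply Ck_plus; [apply Ck_const|].
      apply Ck_mult; [|apply Ck_const].
      apply Ck_plus; [exact HE|].
      apply Ck_inv; [|exact HE].
      intros; apply Rgt_not_eq, exp_pos.
Qed.

(** * Chain rules in three variables *)

Lemma differentiable3_comp f F G x y t :
  ex_filterdiff (fun u : R * R => F (fst u) (snd u)) (locally (x, y)) ->
  ex_filterdiff (fun u : R * R => G (fst u) (snd u)) (locally (x, y)) ->
  differentiable3 f (F x y) (G x y) t ->
  differentiable3 (fun x y t => f (F x y) (G x y) t) x y t.
Proof.
  intros HF HG Hf; unfold differentiable3.
  (* [E] is the change of variables with time left fixed; its differentiability is assembled below
     by pairing components. *)
  set (E := fun p : R * R * R => ((F (fst (fst p)) (snd (fst p)),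
    G (fst (fst p)) (snd (fst p))), snd p)).
  apply (ex_filterdiff_comp' E
    (fun p : R * R * R => f (fst (fst p)) (snd (fst p)) (snd p)) (x, y, t)).
  2: exact Hf.
  assert (H1 : ex_filterdiff (fun p : R * R * R => fst p) (locally (x, y, t)))
    by apply ex_filterdiff_linear, is_linear_fst.
  assert (HF' := ex_filterdiff_comp' _ _ (x, y, t) H1 HF).
  assert (HG' := ex_filterdiff_comp' _ _ (x, y, t) H1 HG).
  apply (ex_filterdiff_comp'_2 (fun p : R * R * R =>
      (F (fst (fst p)) (snd (fst p)), G (fst (fst p)) (snd (fst p))))
    (fun p : R * R * R => snd p) (fun u v => (u, v)) (x, y, t)).
  - apply (ex_filterdiff_comp'_2
      (fun p : R * R * R => F (fst (fst p)) (snd (fst p)))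
      (fun p : R * R * R => G (fst (fst p)) (snd (fst p)))
      (fun u v => (u, v)) (x, y, t)); [exact HF'|exact HG'|].
    apply ex_filterdiff_linear, is_linear_prod;
      [apply is_linear_fst|apply is_linear_snd].
  - apply ex_filterdiff_linear, is_linear_snd.
  - apply ex_filterdiff_linear, is_linear_prod;
      [apply is_linear_fst|apply is_linear_snd].
Qed.

(** Serves to replace a function by its composite with the coordinate change and its inverse, which
    agree only over phase space. *)
Lemma differentiable3_ext_loc f g x y t :
  locally_2d (fun u v => forall s, f u v s = g u v s) x y ->
  differentiable3 f x y t -> differentiable3 g x y t.
Proof.
  intros [d Hd] [l Hl]; exists l.
  apply (filterdiff_ext_locally
    (fun p : R * R * R => f (fst (fst p)) (snd (fst p)) (snd p))
    _ ((x, y, t) : R * R * R) l); [|exact Hl].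
  exists d; intros [[u v] s] [[Hu Hv] _]; apply Hd; assumption.
Qed.

(** The coefficients are the values of the differential on the basis vectors. They are chosen before
    the curve, so derivatives along the axes and along an orbit can be compared. *)
Lemma differentiable3_chain f x y t : differentiable3 f x y t ->
  exists a b c, forall (al be ga : R -> R) s al' be' ga',
    al s = x -> be s = y -> ga s = t ->
    is_derive al s al' -> is_derive be s be' -> is_derive ga s ga' ->
    is_derive (fun s => f (al s) (be s) (ga s)) s (a * al' + b * be' + c * ga').
Proof.
  intros [l Hl]; destruct (proj1 Hl) as [lp ls _].
  assert (lp' : forall x y z x' y' z' : R,
    l (x + x', y + y', z + z') = l (x, y, z) + l (x', y', z'))
    by (intros; apply (lp (_, _, _) (_, _, _))).
  assert (ls' : forall k x y z : R, l (k * x, k * y, k * z) = k * l (x, y, z))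
    by (intros; apply (ls _ (_, _, _))).
  assert (lE : forall x y z : R,
    l (x, y, z) = x * l (1, 0, 0) + y * l (0, 1, 0) + z * l (0, 0, 1)).
  { intros u v w; rewrite <- !ls', <- !lp'; do 2 f_equal; [f_equal|]; ring. }
  exists (l (1, 0, 0)), (l (0, 1, 0)), (l (0, 0, 1)).
  intros al be ga s al' be' ga' <- <- <- Ha Hb Hc.
  unfold is_derive.
  assert (H : filterdiff (fun s => ((al s, be s), ga s)) (locally s)
                (fun h => ((scal h al', scal h be'), scal h ga'))).
  { apply (filterdiff_comp'_2 (fun s => (al s, be s)) ga (fun u v => (u, v)) s
      (fun h => (scal h al', scal h be')) (fun h => scal h ga')
      (fun u v => (u, v))); [|exact Hc|].
    - apply (filterdiff_comp'_2 al be (fun u v => (u, v)) s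
        (fun h => scal h al') (fun h => scal h be') (fun u v => (u, v)));
        [exact Ha|exact Hb|].
      apply filterdiff_linear, is_linear_prod;
        [apply is_linear_fst|apply is_linear_snd].
    - apply filterdiff_linear, is_linear_prod;
        [apply is_linear_fst|apply is_linear_snd]. }
  assert (H2 := filterdiff_comp' _ _ s _ _ H Hl); cbn [fst snd] in H2.
  eapply filterdiff_ext_lin; [exact H2|].
  intros h; cbv beta.
  change (l (h * al', h * be', h * ga') =
    h * (l (1, 0, 0) * al' + l (0, 1, 0) * be' + l (0, 0, 1) * ga')).
  (* The equality is stated in a structure's carrier that is convertible to [R]; [ring] wants [R]
     itself. *)
  rewrite lE; change (@eq ?T ?u ?v) with (@eq R u v); ring.
Qed.

(** * The action-angle coordinates *)

Definition energy_root (q r v : R) : R := sqrt (v ^ 2 + q / r).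

Definition angle (q r v : R) : R :=
  let a := energy_root q r v in
  q / (2 * a ^ 2) * wsinh (ln ((a + v) / (a - v))).

(* This is [exp w], where [w = ln ((a + v) / (a - v))]. *)
Definition eccentric (q theta a : R) : R :=
  exp (wsinh_inv (2 * a ^ 2 / q * theta)).

(** With [X = exp w], [cosh^2 (w/2) = (X + 1)^2 / (4 X)]; likewise [tanh (w/2) = (X - 1) / (X + 1)]
    in [velocity]. These rational forms suit [field]. *)
Definition radius (q theta a : R) : R :=
  q * (eccentric q theta a + 1) ^ 2 / (4 * a ^ 2 * eccentric q theta a).

Definition velocity (q theta a : R) : R :=
  a * (eccentric q theta a - 1) / (eccentric q theta a + 1).

Lemma eccentric_pos q theta a : 0 < eccentric q theta a.
Proof. apply exp_pos. Qed.

Lemma open_phase_space : open_2d phase_space.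
Proof.
  intros r v Hr; exists (mkposreal r Hr); intros u w Hu _; simpl in Hu.
  unfold phase_space; apply Rabs_lt_between' in Hu; lra.
Qed.

Lemma open_action_angle_space : open_2d action_angle_space.
Proof.
  intros th a Ha; exists (mkposreal a Ha); intros u w _ Hw; simpl in Hw.
  unfold action_angle_space; apply Rabs_lt_between' in Hw; lra.
Qed.

(** * The two coordinate maps are mutually inverse, and the change is symplectic *)

Section Coulomb.
Variable q : R.
Hypothesis hq : 0 < q.

(** Since [q / r > 0], the action exceeds the absolute value of [v]; this keeps the argument of the
    logarithm in [angle] positive. *)
Lemma energy_root_spec r v : 0 < r ->
  0 < v ^ 2 + q / r /\ 0 < energy_root q r v /\
  energy_root q r v ^ 2 = v ^ 2 + q / r /\
  0 < energy_root q r v + v /\ 0 < energy_root q r v - v.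
Proof.
  intros Hr.
  assert (Hqr : 0 < q / r) by now apply Rdiv_lt_0_compat.
  pose proof (pow2_ge_0 v) as Hv.
  assert (Hs : 0 < v ^ 2 + q / r) by lra.
  unfold energy_root; pose proof (sqrt_lt_R0 _ Hs) as Ha.
  assert (Ha2 : sqrt (v ^ 2 + q / r) ^ 2 = v ^ 2 + q / r)
    by (apply pow2_sqrt; lra).
  repeat split; [exact Hs|exact Ha|exact Ha2|nra|nra].
Qed.

Lemma radius_velocity_angle r v : 0 < r ->
  radius q (angle q r v) (energy_root q r v) = r /\
  velocity q (angle q r v) (energy_root q r v) = v.
Proof.
  intros Hr; destruct (energy_root_spec r v Hr) as (_ & Ha & Ha2 & Hp & Hm).
  assert (HX : eccentric q (angle q r v) (energy_root q r v) =
    (energy_root q r v + v) / (energy_root q r v - v)).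
  { unfold eccentric, angle; cbv zeta.
    match goal with |- exp (wsinh_inv ?z) = _ =>
      replace z with (wsinh (ln ((energy_root q r v + v) / (energy_root q r v - v))))
        by (field; lra) end.
    rewrite wsinh_inv_wsinh; now apply exp_ln, Rdiv_lt_0_compat. }
  unfold radius, velocity; rewrite HX.
  set (a := energy_root q r v) in *.
  (* The energy relation [a^2 = v^2 + q / r] solved for [q]; eliminating [q] leaves rational
     identities in [r], [v], [a]. *)
  assert (Hq : q = r * ((a + v) * (a - v))).
  { replace ((a + v) * (a - v)) with (a ^ 2 - v ^ 2) by ring.
    rewrite Ha2; field; lra. }
  split; [rewrite Hq|]; field; lra.
Qed.

Lemma angle_energy_root_inv th a : 0 < a ->
  0 < radius q th a /\
  energy_root q (radius q th a) (velocity q th a) = a /\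
  angle q (radius q th a) (velocity q th a) = th.
Proof.
  intros Ha; pose proof (eccentric_pos q th a) as HX.
  assert (HR : 0 < radius q th a).
  { unfold radius; apply Rdiv_lt_0_compat; [apply Rmult_lt_0_compat; [lra|]|];
      [apply pow_lt; lra|].
    apply Rmult_lt_0_compat; [|exact HX]; pose proof (pow_lt a 2 Ha); lra. }
  assert (HE : energy_root q (radius q th a) (velocity q th a) = a).
  { unfold energy_root; rewrite <- (sqrt_pow2 a) at 3 by lra; f_equal.
    (* With [X] the value of [eccentric], this is [(X - 1)^2 + 4 X = (X + 1)^2]. *)
    unfold radius, velocity; field; lra. }
  split; [exact HR|]; split; [exact HE|].
  unfold angle; rewrite HE; cbv zeta.
  replace ((a + velocity q th a) / (a - velocity q th a)) with (eccentric q th a).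
  - unfold eccentric at 1; rewrite ln_exp, wsinh_wsinh_inv; field; lra.
  - unfold velocity; field; repeat split; lra.
Qed.

(** Working along a curve yields both partial derivatives at once. The first term differentiates the
    prefactor; in the second, [2 a^2 / (a^2 - v^2)] is [wsinh' w] and the last factor is the
    derivative of [w]. *)
Lemma is_derive_angle (rho nu : R -> R) (s a' nu' : R) :
  0 < rho s ->
  is_derive (fun s => energy_root q (rho s) (nu s)) s a' ->
  is_derive nu s nu' ->
  let a := energy_root q (rho s) (nu s) in
  let v := nu s in
  let w := ln ((a + v) / (a - v)) in
  is_derive (fun s => angle q (rho s) (nu s)) s
    (- q / a ^ 3 * wsinh w * a' +
     q / (2 * a ^ 2) * (2 * a ^ 2 / (a ^ 2 - v ^ 2)) *
       (2 * (a * nu' - v * a') / (a ^ 2 - v ^ 2))).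
Proof.
  intros Hr Ha Hn; cbv zeta.
  destruct (energy_root_spec (rho s) (nu s) Hr) as (_ & Ha0 & _ & Hp & Hm).
  unfold angle; cbv zeta.
  set (al := fun s => energy_root q (rho s) (nu s)) in *.
  change (energy_root q (rho s) (nu s)) with (al s) in *.
  change (is_derive (fun s => q / (2 * al s ^ 2) *
    wsinh (ln ((al s + nu s) / (al s - nu s)))) s
    (- q / al s ^ 3 * wsinh (ln ((al s + nu s) / (al s - nu s))) * a' +
     q / (2 * al s ^ 2) * (2 * al s ^ 2 / (al s ^ 2 - nu s ^ 2)) *
       (2 * (al s * nu' - nu s * a') / (al s ^ 2 - nu s ^ 2)))).
  change (is_derive al s a') in Ha.
  (* Only the derivative of the action and the sign conditions matter now; hiding its body keeps the
     square root out of the computation. *)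
  clearbody al.
  set (x := (al s + nu s) / (al s - nu s)).
  assert (Hx : 0 < x) by now apply Rdiv_lt_0_compat.
  assert (Hw := is_derive_wsinh (ln x)).
  unfold wsinh' in Hw; rewrite exp_ln in Hw by exact Hx.
  assert (Dw : is_derive (fun s => wsinh (ln ((al s + nu s) / (al s - nu s)))) s
    ((2 * al s ^ 2 / (al s ^ 2 - nu s ^ 2)) *
       (2 * (al s * nu' - nu s * a') / (al s ^ 2 - nu s ^ 2)))).
  { evar_last.
    - apply (is_derive_comp wsinh (fun s => ln ((al s + nu s) / (al s - nu s)))).
      + exact Hw.
      + apply (is_derive_comp ln (fun s => (al s + nu s) / (al s - nu s))).
        * apply is_derive_ln; exact Hx.
        * apply (is_derive_div (fun s => al s + nu s) (fun s => al s - nu s)).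
          -- apply @is_derive_plus; eassumption.
          -- apply @is_derive_minus; eassumption.
          -- lra.
    - unfold x, scal, plus, minus; simpl; unfold mult, plus, opp; simpl.
      field; repeat split; nra. }
  assert (Dc : is_derive (fun s => q / (2 * al s ^ 2)) s (- q / al s ^ 3 * a')).
  { assert (Da : ex_derive al s) by now exists a'.
    auto_derive.
    - split; [exact Da|]; split; [|easy]; nra.
    - rewrite (is_derive_unique (fun s : R => al s) _ _ Ha); field; lra. }
  evar_last; [exact (is_derive_mult _ _ _ _ _ Dc Dw Rmult_comm)|].
  unfold plus, mult; simpl; unfold x; ring.
Qed.

(** Modulo [da], the differential of the angle is [2 q a / (a^2 - v^2)^2 dv]. As the [r]-derivative
    of [a] is [- q / (2 r^2 a)], the wedge has coefficient [q^2 / (r^2 (a^2 - v^2)^2)], which is 1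
    because [a^2 - v^2 = q / r]. *)
Lemma symplectic_angle : symplectic_on phase_space (angle q) (energy_root q).
Proof.
  intros r v Hr h k; unfold phase_space in Hr.
  destruct (energy_root_spec r v Hr) as (Hs & Ha & Ha2 & Hp & Hm).
  set (a := energy_root q r v) in *.
  assert (Dr : is_derive (fun s => energy_root q s v) r (- q / (2 * r ^ 2 * a))).
  { unfold energy_root; auto_derive; [repeat split; lra|].
    change (sqrt _) with a; field; lra. }
  assert (Dv : is_derive (fun s => energy_root q r s) v (v / a)).
  { unfold energy_root; auto_derive; [repeat split; lra|].
    change (sqrt _) with a; field; lra. }
  assert (Tr := is_derive_angle (fun s => s) (fun _ => v) r _ _ Hr Dr
    (is_derive_const v r)).
  assert (Tv := is_derive_angle (fun _ => r) (fun s => s) v _ _ Hr Dv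
    (is_derive_id v)).
  cbv zeta in Tr, Tv; unfold one, zero in Tr, Tv; simpl in Tr, Tv; fold a in Tr, Tv.
  unfold wedge, Defs.differential.
  rewrite (is_derive_unique _ _ _ Dr : Derive (fun s => energy_root q s v) r = _).
  rewrite (is_derive_unique _ _ _ Dv : Derive (fun s => energy_root q r s) v = _).
  rewrite (is_derive_unique _ _ _ Tr : Derive (fun s => angle q s v) r = _).
  rewrite (is_derive_unique _ _ _ Tv : Derive (fun s => angle q r s) v = _).
  rewrite !Derive_id, !Derive_const.
  (* This value multiplies only [da], so it cancels in the wedge and may be arbitrary. *)
  generalize (wsinh (ln ((a + v) / (a - v)))); intros W.
  assert (Hq : q = r * (a ^ 2 - v ^ 2)) by (rewrite Ha2; field; lra).
  destruct h as [h1 h2], k as [k1 k2]; simpl fst; simpl snd.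
  rewrite Hq; field; repeat split; nra.
Qed.

(** In terms of [X = exp w], [wsinh' w = (X + 1)^2 / (2 X)], so [X' = X (2 a^2 / q) / wsinh' w] is
    rational in [X]. *)
Lemma is_derive_eccentric th a : 0 < a ->
  is_derive (fun s => eccentric q s a) th
    (4 * a ^ 2 * eccentric q th a ^ 2 / (q * (eccentric q th a + 1) ^ 2)).
Proof.
  intros Ha; pose proof (eccentric_pos q th a) as HX; unfold eccentric in *.
  evar_last.
  - apply (is_derive_comp exp (fun s => wsinh_inv (2 * a ^ 2 / q * s))).
    + apply is_derive_exp.
    + apply (is_derive_comp wsinh_inv (fun s => 2 * a ^ 2 / q * s)).
      * apply is_derive_wsinh_inv.
      * apply (is_derive_scal (fun s => s)), @is_derive_id.
  - unfold scal, one; simpl; unfold mult; simpl; unfold wsinh'.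
    set (X := exp _) in *; clearbody X; field; repeat split; nra.
Qed.

(** With [is_derive_velocity], this says that at fixed action the curve has tangent
    [(v, q / (2 r^2)) / a]: the equations of motion in the time [theta / a]. *)
Lemma is_derive_radius th a : 0 < a ->
  is_derive (fun s => radius q s a) th (velocity q th a / a).
Proof.
  intros Ha; pose proof (eccentric_pos q th a) as HX.
  pose proof (is_derive_eccentric th a Ha) as HD; unfold radius, velocity.
  set (X := fun s => eccentric q s a) in *.
  change (eccentric q th a) with (X th) in *.
  change (is_derive (fun s => q * (X s + 1) ^ 2 / (4 * a ^ 2 * X s)) th
     (a * (X th - 1) / (X th + 1) / a)).
  change (is_derive X th (4 * a ^ 2 * X th ^ 2 / (q * (X th + 1) ^ 2))) in HD.
  assert (ex_derive X th) by now eexists; exact HD.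
  clearbody X.
  assert (0 < a * a * X th) by (repeat apply Rmult_lt_0_compat; assumption).
  auto_derive.
  - repeat split; auto; nra.
  - rewrite (is_derive_unique (fun s : R => X s) _ _ HD); field; repeat split; nra.
Qed.

Lemma is_derive_velocity th a : 0 < a ->
  is_derive (fun s => velocity q s a) th (q / (2 * radius q th a ^ 2) / a).
Proof.
  intros Ha; pose proof (eccentric_pos q th a) as HX.
  pose proof (is_derive_eccentric th a Ha) as HD; unfold radius, velocity.
  set (X := fun s => eccentric q s a) in *.
  change (eccentric q th a) with (X th) in *.
  change (is_derive (fun s => a * (X s - 1) / (X s + 1)) th
     (q / (2 * (q * (X th + 1) ^ 2 / (4 * a ^ 2 * X th)) ^ 2) / a)).
  change (is_derive X th (4 * a ^ 2 * X th ^ 2 / (q * (X th + 1) ^ 2))) in HD.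
  assert (ex_derive X th) by now eexists; exact HD.
  clearbody X; auto_derive.
  - repeat split; auto; nra.
  - rewrite (is_derive_unique (fun s : R => X s) _ _ HD); field; repeat split; nra.
Qed.

(** * Smoothness of the coordinates and of their inverse *)

Lemma Ck_energy_root n : Ck n phase_space (energy_root q).
Proof.
  (* The square and the quotient are written in unfolded form, convertible to the original, so that
     the closure lemmas match. *)
  apply (Ck_sqrt n phase_space (fun r v => v * (v * 1) + q * / r)).
  - intros r v Hr; apply (energy_root_spec r v Hr).
  - pose proof (Ck_snd n phase_space); pose proof (Ck_const n phase_space).
    repeat (apply Ck_plus || apply Ck_mult); auto.
    apply Ck_inv; [intros r v; unfold phase_space; lra|apply Ck_fst].
Qed.

Lemma Ck_angle n : Ck n phase_space (angle q).
Proof.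
  pose proof (Ck_energy_root n) as HA; pose proof (Ck_snd n phase_space) as Hv.
  assert (Hc := fun c => Ck_const n phase_space c).
  apply Ck_mult.
  - apply Ck_mult; [apply Hc|apply Ck_inv].
    + intros r v Hr; destruct (energy_root_spec r v Hr) as (_ & H & _); nra.
    + apply Ck_mult; [apply Hc|].
      apply Ck_mult; [exact HA|]; apply Ck_mult; [exact HA|apply Hc].
  - apply (Ck_wsinh n phase_space (fun r v =>
      ln ((energy_root q r v + v) / (energy_root q r v - v)))).
    { exact open_phase_space. }
    apply (Ck_ln n phase_space (fun r v =>
      (energy_root q r v + v) / (energy_root q r v - v))).
    + intros r v Hr; destruct (energy_root_spec r v Hr) as (_ & _ & _ & H1 & H2).
      now apply Rdiv_lt_0_compat.
    + apply Ck_mult; [now apply Ck_plus|].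
      apply Ck_inv; [|now apply Ck_minus; [exact open_phase_space|..]].
      intros r v Hr; destruct (energy_root_spec r v Hr) as (_ & _ & _ & H1 & H2).
      lra.
Qed.

Lemma Ck_eccentric n : Ck n action_angle_space (eccentric q).
Proof.
  apply (Ck_exp n action_angle_space (fun th a => wsinh_inv (2 * a ^ 2 / q * th))).
  apply (Ck_wsinh_inv n action_angle_space (fun th a => 2 * (a * (a * 1)) * / q * th)).
  pose proof (Ck_fst n action_angle_space); pose proof (Ck_snd n action_angle_space).
  pose proof (Ck_const n action_angle_space).
  repeat (apply Ck_mult); auto.
Qed.

Lemma Ck_radius n : Ck n action_angle_space (radius q).
Proof.
  pose proof (Ck_eccentric n); pose proof (Ck_snd n action_angle_space).
  pose proof (fun c => Ck_const n action_angle_space c).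
  apply Ck_mult; [|apply Ck_inv].
  - repeat (apply Ck_mult || apply Ck_plus); auto.
  - intros th a Ha; unfold action_angle_space in Ha; pose proof (eccentric_pos q th a).
    apply Rgt_not_eq; repeat apply Rmult_lt_0_compat; lra.
  - repeat (apply Ck_mult || apply Ck_plus); auto.
Qed.

Lemma Ck_velocity n : Ck n action_angle_space (velocity q).
Proof.
  pose proof (Ck_eccentric n); pose proof (Ck_snd n action_angle_space).
  pose proof (fun c => Ck_const n action_angle_space c).
  apply Ck_mult; [apply Ck_mult|apply Ck_inv]; auto.
  - now apply Ck_minus; [exact open_action_angle_space|..].
  - intros th a _; pose proof (eccentric_pos q th a); lra.
  - now apply Ck_plus.
Qed.

(** * The canonical transformation and the correspondence of the two equations *)

Lemma canonical_angle : canonical_transformation phase_space action_angle_space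
  (angle q) (energy_root q) (radius q) (velocity q).
Proof.
  split; [|exact symplectic_angle].
  repeat split.
  - intros r v Hr; apply (energy_root_spec r v Hr).
  - intros th a Ha; apply (angle_energy_root_inv th a Ha).
  - now apply radius_velocity_angle.
  - now apply radius_velocity_angle.
  - now apply angle_energy_root_inv.
  - now apply angle_energy_root_inv.
  - intros n x y; apply Ck_ex_diff_n; [exact open_phase_space|apply Ck_angle].
  - intros n x y; apply Ck_ex_diff_n; [exact open_phase_space|apply Ck_energy_root].
  - intros n x y; apply Ck_ex_diff_n; [exact open_action_angle_space|apply Ck_radius].
  - intros n x y; apply Ck_ex_diff_n; [exact open_action_angle_space|apply Ck_velocity].
Qed.

(** The tangent to the orbit is the transport field divided by [a], and the factor [a] in free
    streaming cancels this division. *)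
Lemma transport_free_streaming (f : R -> R -> R -> R) th a t : 0 < a ->
  differentiable3 f (radius q th a) (velocity q th a) t ->
  let r := radius q th a in
  let v := velocity q th a in
  Derive (fun s => f (radius q th a) (velocity q th a) s) t +
    a * Derive (fun s => f (radius q s a) (velocity q s a) t) th =
  Derive (fun s => f r v s) t + v * Derive (fun s => f s v t) r
      + q / (2 * r ^ 2) * Derive (fun s => f r s t) v.
Proof.
  intros Ha Hf; cbv zeta.
  destruct (angle_energy_root_inv th a Ha) as (HR & _ & _).
  destruct (differentiable3_chain f _ _ _ Hf) as (A & B & C & HD).
  set (r := radius q th a) in *; set (v := velocity q th a) in *.
  assert (Hc : forall c s : R, is_derive (fun _ : R => c) s 0)
    by (intros; apply @is_derive_const).
  assert (Hi : forall s : R, is_derive (fun s : R => s) s 1)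
    by (intros; apply @is_derive_id).
  rewrite (is_derive_unique _ _ _
    (HD (fun _ => r) (fun _ => v) (fun s => s) t _ _ _ eq_refl eq_refl eq_refl
      (Hc _ _) (Hc _ _) (Hi _)) : Derive (fun s => f r v s) t = _).
  rewrite (is_derive_unique _ _ _
    (HD (fun s => s) (fun _ => v) (fun _ => t) r _ _ _ eq_refl eq_refl eq_refl
      (Hi _) (Hc _ _) (Hc _ _)) : Derive (fun s => f s v t) r = _).
  rewrite (is_derive_unique _ _ _
    (HD (fun _ => r) (fun s => s) (fun _ => t) v _ _ _ eq_refl eq_refl eq_refl
      (Hc _ _) (Hi _) (Hc _ _)) : Derive (fun s => f r s t) v = _).
  rewrite (is_derive_unique _ _ _
    (HD (fun s => radius q s a) (fun s => velocity q s a) (fun _ => t) th _ _ _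
      eq_refl eq_refl eq_refl
      (is_derive_radius th a Ha) (is_derive_velocity th a Ha) (Hc _ _)) :
    Derive (fun s => f (radius q s a) (velocity q s a) t) th = _).
  fold r v; field; lra.
Qed.

End Coulomb.

Theorem lemma1p3 (q : R) (hq : 0 < q) :
  exists Theta Act Rad Vel : R -> R -> R,
    canonical_transformation phase_space action_angle_space
      Theta Act Rad Vel /\
    forall (J : R -> Prop) (f : R -> R -> R -> R), open J ->
      (solves_transport q J f <->
       solves_free_streaming J
         (fun theta a t => f (Rad theta a) (Vel theta a) t)).
Proof.
  exists (angle q), (energy_root q), (radius q), (velocity q).
  split; [exact (canonical_angle q hq)|].
  intros J f _; split.
  - intros Hf th a t Ha Ht.
    destruct (angle_energy_root_inv q hq th a Ha) as (HR & _ & _).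
    destruct (Hf _ (velocity q th a) t HR Ht) as [Hd He]; split.
    + apply differentiable3_comp; [..|exact Hd];
        apply (Ck_filterdiff action_angle_space);
        auto using open_action_angle_space, Ck_radius, Ck_velocity.
    + rewrite (transport_free_streaming q hq f th a t Ha Hd); exact He.
  - intros Hg r v t Hr Ht.
    destruct (energy_root_spec q hq r v Hr) as (_ & Ha & _).
    destruct (Hg (angle q r v) (energy_root q r v) t Ha Ht) as [Hd He].
    (* Near [(r, v)], [f] is the transformed function composed with [angle] and [energy_root], hence
       inherits its differentiability. *)
    assert (Hf : differentiable3 f r v t).
    { apply differentiable3_ext_loc with (2 := differentiable3_comp _ _ _ r v t
        (Ck_filterdiff phase_space _ r v open_phase_space (Ck_angle q hq 1) Hr)
        (Ck_filterdiff phase_space _ r v open_phase_space (Ck_energy_root q hq 1) Hr)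
        Hd).
      destruct (open_phase_space r v Hr) as [d HDd]; exists d.
      intros u w Hu Hw s; destruct (radius_velocity_angle q hq u w (HDd u w Hu Hw)) as [-> ->].
      reflexivity. }
    split; [exact Hf|].
    destruct (radius_velocity_angle q hq r v Hr) as [ER EV].
    pose proof (transport_free_streaming q hq f (angle q r v) (energy_root q r v)
      t Ha) as HT; rewrite ER, EV in HT; specialize (HT Hf).
    cbv zeta in HT; rewrite ER, EV in He; rewrite He in HT; now symmetry.
Qed.
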